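(* Let $x_0,\dots,x_m\in\mathbb{C}^n$ be such that $x_0,\dots,x_{m-1}$ are linearly independent and $x_1,\dots,x_m$ are linearly independent. Let $A=YX^+\in\mathbb{C}^{n\times n}$ be the system matrix to the data, where $X=[x_0\ \cdots\ x_{m-1}]$ and $Y=[x_1\ \cdots\ x_m]$. If $A$ has $m$ non-zero distinct eigenvalues, then $A$ is diagonalizable.
   Context: $X^+$ denotes the Moore-Penrose pseudoinverse of $X$. The matrix $A=YX^+$ is called the system matrix to the data $x_0,\dots,x_m$. *)

(* Defs.v *)
From mathcomp Require Import all_boot all_order all_algebra.
From mathcomp Require Import complex.
From mathcomp Require Import reals.

Set Implicit Arguments.
Unset Strict Implicit.
Unset Printing Implicit Defensive.

Import Order.TTheory GRing.Theory Num.Theory.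
Local Open Scope ring_scope.
Local Open Scope sesquilinear_scope.

Section MoorePenrose.
Variable C : numClosedFieldType.

(* The four Penrose equations; [^t*] is the conjugate transpose. *)
Definition penrose p q (X : 'M[C]_(p, q)) (P : 'M[C]_(q, p)) : bool :=
  [&& X *m P *m X == X, P *m X *m P == P,
      (X *m P) ^t* == X *m P & (P *m X) ^t* == P *m X].

Lemma trmxC_mul p q r (A : 'M[C]_(p, q)) (B : 'M[C]_(q, r)) :
  (A *m B) ^t* = B ^t* *m A ^t*.
Proof. by rewrite trmx_mul map_mxM. Qed.

Lemma mul_trmxC_eq0 p q (A : 'M[C]_(p, q)) : A *m A ^t* = 0 -> A = 0.
Proof.
move=> A0; apply/matrixP => i j; rewrite [RHS]mxE.
have /eqP := congr1 (fun M : 'M_p => M i i) A0; rewrite !mxE.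
under eq_bigr do rewrite !mxE -normCK.
rewrite psumr_eq0 => [/allP/(_ j)|k _]; last exact: exprn_ge0.
by rewrite mem_index_enum expf_eq0 normr_eq0 => /(_ isT)/eqP.
Qed.

Lemma row_free_gram p q (A : 'M[C]_(p, q)) :
  row_free A -> A *m A ^t* \in unitmx.
Proof.
move=> fA; rewrite -row_free_unit -kermx_eq0; set K := kermx _.
have : (K *m A) *m (K *m A) ^t* = 0.
  by rewrite trmxC_mul mulmxA -(mulmxA K) mulmx_ker mul0mx.
by move/mul_trmxC_eq0/eqP; rewrite mulmx_free_eq0.
Qed.

Lemma penrose_factor p r q (L : 'M[C]_(p, r)) (U : 'M[C]_(r, q)) :
  row_full L -> row_free U -> exists P, penrose (L *m U) P.
Proof.
move=> fL fU.
have uU : U *m U ^t* \in unitmx by apply: row_free_gram.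
have uL : L ^t* *m L \in unitmx.
  rewrite -{2}[L]trmxCK; apply: row_free_gram.
  by rewrite /row_free mxrank_map mxrank_tr.
pose G := invmx (U *m U ^t*); pose H := invmx (L ^t* *m L).
have GU : U *m U ^t* *m G = 1%:M by rewrite mulmxV.
have HL : H *m (L ^t* *m L) = 1%:M by rewrite mulVmx.
have sG : G ^t* = G by rewrite trmx_inv map_invmx trmxC_mul trmxCK.
have sH : H ^t* = H by rewrite trmx_inv map_invmx trmxC_mul trmxCK.
exists (U ^t* *m G *m (H *m L ^t*)).
have XP : L *m U *m (U ^t* *m G *m (H *m L ^t*)) = L *m (H *m L ^t*).
  by rewrite (mulmxA (L *m U)) -(mulmxA L) (mulmxA U) GU mulmx1.
have PX : U ^t* *m G *m (H *m L ^t*) *m (L *m U) = U ^t* *m G *m U.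
  by rewrite (mulmxA _ L) -(mulmxA _ _ L) -(mulmxA H) HL mulmx1.
apply/and4P; split; apply/eqP.
- by rewrite XP mulmxA -(mulmxA L) -(mulmxA H) HL mulmx1.
- by rewrite PX mulmxA -(mulmxA _ U) (mulmxA U) GU mulmx1.
- by rewrite XP !trmxC_mul trmxCK sH mulmxA.
- by rewrite PX !trmxC_mul trmxCK sG mulmxA.
Qed.

Lemma penrose_exists p q (X : 'M[C]_(p, q)) : exists P, penrose X P.
Proof.
rewrite -[X]mulmx_base.
exact: (penrose_factor (col_base_full X) (row_base_free X)).
Qed.

Lemma penrose_uniq p q (X : 'M[C]_(p, q)) (P Q : 'M[C]_(q, p)) :
  penrose X P -> penrose X Q -> P = Q.
Proof.
move=> /and4P[/eqP XPX /eqP PXP /eqP sXP /eqP sPX].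
move=> /and4P[/eqP XQX /eqP QXQ /eqP sXQ /eqP sQX].
have eXP : X *m P = X *m Q.
  rewrite -sXP -{1}XQX -(mulmxA (X *m Q)) trmxC_mul sXP sXQ.
  by rewrite mulmxA XPX.
have ePX : P *m X = Q *m X.
  rewrite -sPX -{1}XQX -(mulmxA X) mulmxA trmxC_mul sQX.
  by rewrite sPX -mulmxA (mulmxA X) XPX.
by rewrite -PXP -mulmxA eXP mulmxA ePX QXQ.
Qed.

(* The unique solution of the Penrose equations, by penrose_exists and
   penrose_uniq. *)
Definition mp_pinv p q (X : 'M[C]_(p, q)) : 'M[C]_(q, p) :=
  xchoose (penrose_exists X).

Lemma mp_pinvP p q (X : 'M[C]_(p, q)) : penrose X (mp_pinv X).
Proof. exact: xchooseP. Qed.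

Definition init_data n m (x : 'I_m.+1 -> 'cV[C]_n) : 'I_m -> 'cV[C]_n :=
  fun j => x (widen_ord (leqnSn m) j).

Definition shift_data n m (x : 'I_m.+1 -> 'cV[C]_n) : 'I_m -> 'cV[C]_n :=
  fun j => x (lift ord0 j).

Definition mx_of_cols n m (v : 'I_m -> 'cV[C]_n) : 'M[C]_(n, m) :=
  \matrix_(i < n, j < m) v j i 0.

(* Data are column vectors; mathcomp's [eigenvalue] and [diagonalizable] act on
   row vectors, which yields the same notions for a square matrix. *)
Definition system_matrix n m (x : 'I_m.+1 -> 'cV[C]_n) : 'M[C]_n :=
  mx_of_cols (shift_data x) *m mp_pinv (mx_of_cols (init_data x)).

End MoorePenrose.

(* Main.v *)
Require Import Defs.
From mathcomp Require Import all_boot all_order all_algebra.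
From mathcomp Require Import complex.
From mathcomp Require Import reals.

Import GRing.Theory.
Local Open Scope ring_scope.
Local Open Scope complex_scope.

(** The argument is a dimension count. Since [A = Y X^+] factors through an
    [m]-dimensional space, its rank is at most [m], so its kernel, which is the
    eigenspace of [0], has dimension at least [n - m]. The [m] distinct non-zero
    eigenvalues contribute at least one dimension each, and eigenspaces of
    distinct scalars are in direct sum; hence the eigenspaces together have
    dimension at least [n] and span the whole space
    ([diagonalizable_of_rank_le_eigenvalues]). *)

(** When [A] is invertible the scalar [0] is not an eigenvalue, but its trivial
    eigenspace may still be added to the sum without harm: [0 :: s] serves for
    every rank of [A]. *)
Lemma diagonalizable_of_rank_le_eigenvalues (F : fieldType) (n : nat)
    (A : 'M[F]_n) (s : seq F) :
  uniq s -> 0 \notin s -> (forall a, a \in s -> eigenvalue A a) ->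
  (\rank A <= size s)%N -> diagonalizable A.
Proof.
move=> us s0 eigs rkA; apply/diagonalizablePeigen.
have us0 : uniq (0 :: s) by rewrite /= s0.
exists (0 :: s) => //; apply/eqmxP; rewrite submx1 sub1mx -col_leq_rank.
(* Indexing by positions turns the absence of repetitions into injectivity. *)
rewrite (big_nth 0) big_mkord.
have /mxdirectP /= -> :
    mxdirect (\sum_(i < size (0 :: s)) eigenspace A (0 :: s)`_i).
  apply: mxdirect_sum_eigenspace => i j _ _ eq_ij; apply/val_inj.
  by apply: (uniqP 0 us0) eq_ij; rewrite inE.
rewrite big_ord_recl /= /eigenspace raddf0 subr0 mxrank_ker.
rewrite -leq_subLR subKn ?rank_leq_row // (leq_trans rkA) //.
rewrite -[leqLHS]card_ord -sum1_card leq_sum // => i _.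
by rewrite lt0n mxrank_eq0; apply: (eigs s`_i); rewrite mem_nth.
Qed.

Theorem corollary3p5 (R : realType) (n m : nat)
    (x : 'I_m.+1 -> 'cV[R[i]]_n)
    (free_init : free [seq init_data x j | j : 'I_m])
    (free_shift : free [seq shift_data x j | j : 'I_m])
    (eigs : exists s : seq R[i],
       [/\ size s = m, uniq s, 0 \notin s
         & forall a, a \in s -> eigenvalue (system_matrix x) a]) :
  diagonalizable (system_matrix x).
Proof.
case: eigs => s [szs us s0 eigs].
apply: diagonalizable_of_rank_le_eigenvalues us s0 eigs _.
by rewrite szs (leq_trans (mxrankM_maxl _ _)) // rank_leq_col.
Qed.
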